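(* Let $n\ge 1$, let $Q$ be a real $n\times n$ matrix, let $f(x)=x^TQx$ be the associated quadratic form, and let $r\ge 2$ be an integer. Then $$f_{\Delta(n,r)}-f_{\min}^{(r-2)}\le \frac{1}{r-1}\left(Q_{\max}-f_{\Delta(n,r)}\right)\le \frac{1}{r-1}\left(\overline{f}-\underline{f}\right),$$ where $Q_{\max}:=\max_{i\in\{1,\dots,n\}}Q_{ii}$.
   Context: The standard simplex is $\Delta_n:=\{x\in\mathbb{R}^n: x_i\ge 0 \text{ for all } i,\ \sum_{i=1}^n x_i=1\}$. Put $\underline{f}:=\min_{x\in\Delta_n}f(x)$ and $\overline{f}:=\max_{x\in\Delta_n}f(x)$. For an integer $r\ge 1$, the regular grid is $\Delta(n,r):=\{x\in\Delta_n: rx\in\mathbb{N}^n\}$, where $\mathbb{N}^n$ is the set of nonnegative integer vectors, and $f_{\Delta(n,r)}:=\min_{x\in\Delta(n,r)}f(x)$. For a real homogeneous polynomial $f$ of degree $d$ in $x_1,\dots,x_n$ and an integer $r\ge d$, the quantity $f_{\min}^{(r-d)}$ is the maximum of all real $\lambda$ such that the polynomial $\left(\sum_{i=1}^n x_i\right)^{r-d}\left(f-\lambda\left(\sum_{i=1}^n x_i\right)^d\right)$ has only nonnegative coefficients; here $d=2$. *)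

(* Defs.v *)
From mathcomp Require Import all_boot all_order all_algebra.
From mathcomp Require Import boolp classical_sets reals.
From mathcomp.multinomials Require Import mpoly.

Set Implicit Arguments.
Unset Strict Implicit.
Unset Printing Implicit Defensive.

Import Order.TTheory GRing.Theory Num.Theory.

Local Open Scope classical_set_scope.
Local Open Scope ring_scope.

(* The least and greatest elements of a set of reals. They must belong to the
   set, unlike [inf] and [sup]; without such an element the value is 0. *)
Definition set_min (R : realType) (A : set R) : R :=
  xget 0 [set m | A m /\ lbound A m].

Definition set_max (R : realType) (A : set R) : R :=
  xget 0 [set m | A m /\ ubound A m].

Definition simplex (R : realType) (n : nat) : set 'cV[R]_n :=
  [set x | (forall i, 0 <= x i 0) /\ \sum_i x i 0 = 1].
Arguments simplex : clear implicits.

Definition grid (R : realType) (n r : nat) : set 'cV[R]_n :=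
  [set x | simplex R n x /\ forall i, r%:R * x i 0 \is a Num.nat].
Arguments grid : clear implicits.

Definition pval (R : realType) (n : nat) (f : {mpoly R[n]}) (x : 'cV[R]_n) : R :=
  f.@[fun i => x i 0].

Definition simplex_min (R : realType) (n : nat) (f : {mpoly R[n]}) : R :=
  set_min [set pval f x | x in simplex R n].

Definition simplex_max (R : realType) (n : nat) (f : {mpoly R[n]}) : R :=
  set_max [set pval f x | x in simplex R n].

Definition grid_min (R : realType) (n r : nat) (f : {mpoly R[n]}) : R :=
  set_min [set pval f x | x in grid R n r].

(* For [f] homogeneous of degree [d], [polya_bound d k f] is f_min^(k), where
   [k = r - d] is the exponent of the multiplier. *)
Definition polya_bound (R : realType) (n d k : nat) (f : {mpoly R[n]}) : R :=
  let s : {mpoly R[n]} := \sum_(i < n) 'X_i in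
  set_max [set l : R | forall m : 'X_{1..n},
                         0 <= (s ^+ k * (f - l *: s ^+ d))@_m].

(* The matrix product x^T Q x, with x the column of indeterminates. *)
Definition quad_form (R : realType) (n : nat) (Q : 'M[R]_n) : {mpoly R[n]} :=
  let x : 'cV[{mpoly R[n]}]_n := \col_i 'X_i in
  (x^T *m map_mx (@mpolyC n R) Q *m x) 0 0.

Lemma pval_quad_form (R : realType) (n : nat) (Q : 'M[R]_n) (x : 'cV[R]_n) :
  pval (quad_form Q) x = (x^T *m Q *m x) 0 0.
Proof.
rewrite /pval /quad_form !mxE raddf_sum /=; apply: eq_bigr => j _.
rewrite rmorphM /= !mxE mevalXU; congr (_ * _).
rewrite raddf_sum /=; apply: eq_bigr => i _.
by rewrite rmorphM /= !mxE mevalXU mevalC.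
Qed.

Definition diag_max (R : realType) (n : nat) (Q : 'M[R]_n) : R :=
  set_max [set Q i i | i in [set: 'I_n]].

(* Main.v *)
(* Let s be the sum of the variables and c_m >= 0 the coefficient of s^r at the
   monomial m. The Euler operator x_i d_i multiplies the coefficient at m by m_i,
   so x_i x_j d_i d_j s^r = r (r - 1) x_i x_j s^(r-2) shows that r (r - 1) times
   the coefficient of s^(r-2) f at m is (m^T Q m - sum_i Q_ii m_i) c_m. For
   |m| = r the point m / r lies in the grid, so this is at least
   (r^2 f_Delta(n,r) - r Q_max) c_m. Hence f_Delta(n,r) - (Q_max - f_Delta(n,r)) / (r - 1)
   is admissible in the definition of f_min^(r-2), which is the first inequality.
   The second one holds since Q_ii is the value of f at a vertex of the simplex. *)

Require Import Defs.
From mathcomp Require Import all_boot all_order all_algebra.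
From mathcomp.multinomials Require Import mpoly.
From mathcomp Require Import boolp classical_sets functions cardinality.
From mathcomp Require Import reals topology normedtype derive realfun.
From mathcomp Require Import ring.

Set Implicit Arguments.
Unset Strict Implicit.
Unset Printing Implicit Defensive.

Import Order.TTheory GRing.Theory Num.Theory.
Import numFieldNormedType.Exports.

Local Open Scope classical_set_scope.
Local Open Scope ring_scope.

(** * Least and greatest elements of sets of reals *)

(** Any witness of a least element excludes the default value 0 of [xget]. *)
Lemma set_min_spec (R : realType) (A : set R) m :
  A m -> lbound A m -> A (set_min A) /\ lbound A (set_min A).
Proof.
move=> Am lbm; apply: (xgetPex 0 (P := [set m | A m /\ lbound A m])).
by exists m.
Qed.

Lemma set_max_spec (R : realType) (A : set R) m :
  A m -> ubound A m -> A (set_max A) /\ ubound A (set_max A).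
Proof.
move=> Am ubm; apply: (xgetPex 0 (P := [set m | A m /\ ubound A m])).
by exists m.
Qed.

Lemma compact_set_min (R : realType) (A : set R) :
  A !=set0 -> compact A -> A (set_min A) /\ lbound A (set_min A).
Proof.
move=> A0 cA.
have [] := @compact_EVT_min _ _ idfun A A0 cA.
  by apply: continuous_subspaceT => x; exact: cvg_id.
move=> m; rewrite inE => Am mA; apply: (@set_min_spec _ _ m) => // x Ax.
by apply: mA; rewrite inE.
Qed.

Lemma compact_set_max (R : realType) (A : set R) :
  A !=set0 -> compact A -> A (set_max A) /\ ubound A (set_max A).
Proof.
move=> A0 cA.
have [] := @compact_EVT_max _ _ idfun A A0 cA.
  by apply: continuous_subspaceT => x; exact: cvg_id.
move=> m; rewrite inE => Am mA; apply: (@set_max_spec _ _ m) => // x Ax.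
by apply: mA; rewrite inE.
Qed.

(** * Attained extrema over the simplex, the grid and the diagonal *)

Section Simplex.
Variables (R : realType) (n : nat).

Lemma simplex_delta (i : 'I_n) : simplex R n (delta_mx i 0).
Proof.
split=> [j|]; first by rewrite mxE ler0n.
rewrite (bigD1 i) //= mxE !eqxx big1 ?addr0 // => j ji.
by rewrite mxE (negbTE ji).
Qed.

Lemma simplex_le1 (x : 'cV[R]_n) i : simplex R n x -> x i 0 <= 1.
Proof.
case=> x0 <-; rewrite (bigD1 i) //= lerDl; exact: sumr_ge0.
Qed.

(** Points are transposed to rows here because compactness of boxes, [rV_compact], is about row
    vectors. *)
Lemma pval_continuous (f : {mpoly R[n]}) :
  continuous (fun v : 'rV[R]_n => pval f v^T).
Proof.
rewrite /pval; under eq_fun do rewrite mevalE.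
apply: continuous_big; first exact: add_continuous.
move=> m _ v.
apply: (@continuous_comp _ _ _ (fun v : 'rV[R]_n => \prod_i v^T i 0 ^+ m i)
  ( *%R f@_m)).
  move: v; apply: continuous_big; first exact: mul_continuous.
  move=> i _ v.
  have -> : (fun v : 'rV[R]_n => v^T i 0 ^+ m i)
            = (fun y => y ^+ m i) \o (fun v : 'rV[R]_n => v 0 i).
    by apply/funext => u /=; rewrite mxE.
  apply: continuous_comp; first exact: coord_continuous.
  exact: exprn_continuous.
exact: mulrl_continuous.
Qed.

(** The simplex is a closed subset of the unit cube. *)
Lemma compact_trmx_simplex : compact [set v : 'rV[R]_n | simplex R n v^T].
Proof.
have boxc : compact [set v : 'rV[R]_n | forall i, v ord0 i \in `[0, 1]].
  apply: (@rV_compact _ _ (fun _ : 'I_n => `[0 : R, 1]%classic)) => _.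
  exact: segment_compact.
apply: (subclosed_compact _ boxc); last first.
  move=> v /= sv i; have := simplex_le1 i sv; case: sv => /(_ i) + _.
  by rewrite mxE /= in_itv /= => -> ->.
rewrite (_ : [set v | _] =
  (\bigcap_(i in [set: 'I_n]) [set v : 'rV[R]_n | 0 <= v 0 i]) `&`
  [set v | \sum_i v 0 i = 1]); last first.
  apply/seteqP; split=> v /=.
    case=> v0 v1; split; first by move=> i _ /=; have := v0 i; rewrite mxE.
    by rewrite -v1; apply: eq_bigr => i _; rewrite mxE.
  case=> v0 v1; split; first by move=> i; rewrite mxE; exact: v0.
  by rewrite -v1; apply: eq_bigr => i _; rewrite mxE.
apply: closedI.
  apply: closed_bigI => i _.
  apply: (@preimage_closed _ _ (fun v : 'rV[R]_n => v 0 i) [set y | 0 <= y]).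
    by move=> v _; exact: coord_continuous.
  exact: closed_ge.
apply: (@preimage_closed _ _ (fun v : 'rV[R]_n => \sum_i v 0 i) [set y | y = 1]).
  move=> v _; move: v; apply: (@continuous_big _ _ +%R 0 xpredT).
    exact: add_continuous.
  by move=> i _; exact: coord_continuous.
exact: closed_eq.
Qed.

Lemma compact_simplex_image (f : {mpoly R[n]}) :
  compact [set pval f x | x in simplex R n].
Proof.
rewrite (_ : [set _ | _ in _] =
  [set pval f v^T | v in [set v : 'rV[R]_n | simplex R n v^T]]).
  apply: continuous_compact compact_trmx_simplex.
  exact/continuous_subspaceT/pval_continuous.
apply/seteqP; split=> _ [x sx <-]; last by exists x^T.
by exists x^T; rewrite /= trmxK.
Qed.

(** The point [x] itself shows that the simplex is nonempty, so the minimum over its compact image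
    is attained. *)
Lemma simplex_min_le (f : {mpoly R[n]}) x :
  simplex R n x -> simplex_min f <= pval f x.
Proof.
move=> sx; have [] := compact_set_min _ (@compact_simplex_image f).
  by exists (pval f x), x.
by move=> _; apply; exists x.
Qed.

Lemma le_simplex_max (f : {mpoly R[n]}) x :
  simplex R n x -> pval f x <= simplex_max f.
Proof.
move=> sx; have [] := compact_set_max _ (@compact_simplex_image f).
  by exists (pval f x), x.
by move=> _; apply; exists x.
Qed.

Lemma finite_grid r : (0 < r)%N -> finite_set (grid R n r).
Proof.
move=> r0; have rR : r%:R != 0 :> R by rewrite pnatr_eq0 -lt0n.
pose g (t : {ffun 'I_n -> 'I_r.+1}) : 'cV[R]_n := \col_i ((t i)%:R / r%:R).
apply: (@sub_finite_set _ _ (g @` [set: {ffun 'I_n -> 'I_r.+1}])); last first.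
  exact/finite_image/finite_finset.
move=> x [sx xN] /=.
(* The coordinates of r x are naturals at most r, so [inord] does not alter them. *)
exists [ffun i => inord (Num.truncn (r%:R * x i 0))] => //.
apply/matrixP => i j; rewrite (ord1 j) !mxE ffunE.
have [k xk] := natrP (xN i); rewrite xk natrK inordK; last first.
  rewrite ltnS -(ler_nat R) -xk -[leRHS]mulr1 ler_wpM2l //.
  exact: simplex_le1.
by rewrite -xk mulrAC divff ?mul1r.
Qed.

Lemma grid_min_spec r (f : {mpoly R[n]}) : (0 < n)%N -> (0 < r)%N ->
  (exists2 x, grid R n r x & grid_min r f = pval f x) /\
  (forall x, grid R n r x -> grid_min r f <= pval f x).
Proof.
move=> n0 r0.
have [||[x gx xE] lb] := @compact_set_min _ [set pval f x | x in grid R n r].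
(* A vertex of the simplex lies in every grid. *)
- pose i := Ordinal n0; exists (pval f (delta_mx i 0)), (delta_mx i 0) => //.
  split; first exact: simplex_delta.
  by move=> j; rewrite mxE -natrM natr_nat.
- exact/finite_compact/finite_image/finite_grid.
by split; [exists x | move=> y gy; apply: lb; exists y].
Qed.

Lemma diag_max_spec (Q : 'M[R]_n) : (0 < n)%N ->
  (exists i, diag_max Q = Q i i) /\ (forall i, Q i i <= diag_max Q).
Proof.
move=> n0.
have [||[i _ iE] ub] := @compact_set_max _ [set Q i i | i in [set: 'I_n]].
- by exists (Q (Ordinal n0) (Ordinal n0)), (Ordinal n0).
- exact/finite_compact/finite_image/finite_finset.
by split; [exists i | move=> j; apply: ub; exists j].
Qed.

End Simplex.

(** * Coefficients of powers of the sum of the variables *)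

Section PowersOfSum.
Variables (R : realType) (n : nat).
Implicit Types (p : {mpoly R[n]}) (m : 'X_{1..n}).

Local Notation s := (\sum_(i < n) 'X_i : {mpoly R[n]}).

Lemma mcoeff_Xmderiv p i m : ('X_i * p^`M(i))@_m = (m i)%:R * p@_m.
Proof.
rewrite mulrC; have [mi0|mi0] := posnP (m i).
  rewrite mi0 mul0r; apply: memN_msupp_eq0.
  apply/negP => /msuppM_le /allpairsP [[m1 m2]] /= [_ + mE].
  rewrite msuppX inE => /eqP m2E; move: mi0; rewrite mE m2E.
  by rewrite mnmDE mnm1E eqxx addn1.
(* Subtraction of monomials truncates; the factor x_i can be split off because m_i > 0. *)
have mE : m = (U_(i) + (m - U_(i)))%MM.
  by rewrite addmC submK // lep1mP -lt0n.
rewrite {1}mE mcoeffMX mcoeff_deriv addmC -mE mnmBE mnm1E eqxx subn1 prednK //.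
by rewrite mulr_natl.
Qed.

Lemma mderiv_var i j : ('X_j)^`M(i) = (j == i)%:R :> {mpoly R[n]}.
Proof.
rewrite mderivX mnm1E; have [->|_] := eqVneq j i; last by rewrite scale0r.
by rewrite -{1}[U_(i)%MM]add0m addmK mpolyX0 scale1r.
Qed.

Lemma mderiv_sumX i : s^`M(i) = 1.
Proof.
rewrite raddf_sum /= (bigD1 i) //= mderiv_var eqxx big1 ?addr0 // => j ji.
by rewrite mderiv_var (negbTE ji).
Qed.

Lemma mderiv_sumX_exp k i : (s ^+ k.+1)^`M(i) = k.+1%:R *: s ^+ k.
Proof.
elim: k => [|k IH]; first by rewrite expr1 mderiv_sumX expr0 scale1r.
rewrite exprS mderivM IH mderiv_sumX mul1r -scalerAr -exprS.
by rewrite -{1}[s ^+ k.+1]scale1r -scalerDl addrC natr1.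
Qed.

(** These are multinomial coefficients, but only their sign matters. By induction on the degree, it
    is read off from d_i s^(k+1) = (k+1) s^k at the monomial m / x_i, for some x_i dividing m. *)
Lemma mcoeff_sumX_exp_gt0 m : 0 < (s ^+ mdeg m)@_m.
Proof.
have [k mk] : exists k, mdeg m = k by exists (mdeg m).
rewrite mk; elim: k m mk => [|k IH] m mk.
  by move/eqP: mk; rewrite mdeg_eq0 => /eqP ->; rewrite expr0 mcoeff1 eqxx ltr01.
have [i mi0] : exists i, (0 < m i)%N.
  apply/existsP; apply: contra_eqT mk => /existsPn m0.
  by rewrite mdegE big1 // => i _; apply/eqP; rewrite -leqn0 leqNgt.
have mE : m = (m - U_(i) + U_(i))%MM by rewrite submK // lep1mP -lt0n.
have := congr1 (mcoeff (m - U_(i))) (mderiv_sumX_exp k i).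
rewrite mcoeff_deriv -mE mcoeffZ => cE.
suff: 0 < (s ^+ k.+1)@_m *+ ((m - U_(i))%MM i).+1 by rewrite pmulrn_lgt0.
rewrite cE mulr_gt0 ?ltr0n // IH //.
by move: mk; rewrite {1}mE mdegD mdeg1 addn1 => -[].
Qed.

Lemma sumX_exp_homog k : s ^+ k \is k.-homog.
Proof.
rewrite -mesym1E -[X in X.-homog]mul1n; apply: dhomogMn; exact: dhomog_mesym.
Qed.

Lemma mcoeff_sumX_exp0 k m : mdeg m != k -> (s ^+ k)@_m = 0.
Proof. exact/dhomog_nemf_coeff/sumX_exp_homog. Qed.

Lemma mcoeff_sumX_exp_ge0 k m : 0 <= (s ^+ k)@_m.
Proof.
have [<-|mk] := eqVneq (mdeg m) k; first exact/ltW/mcoeff_sumX_exp_gt0.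
by rewrite mcoeff_sumX_exp0.
Qed.

(* Both sides are the coefficient at [m] of x_i x_j d_i d_j s^(k+2). *)
Lemma mcoeff_sumX_expXX k m i j :
  k.+2%:R * k.+1%:R * (s ^+ k * ('X_i * 'X_j))@_m
  = ((m i)%:R * (m j)%:R - (i == j)%:R * (m i)%:R) * (s ^+ k.+2)@_m.
Proof.
have := mcoeff_Xmderiv ('X_i * (s ^+ k.+2)^`M(i)) j m.
rewrite [in RHS]mcoeff_Xmderiv mderivM mulrDr mcoeffD.
(* The product rule term in which x_i itself is differentiated gives the correction for i = j. *)
have -> : ('X_j * (('X_i)^`M(j) * (s ^+ k.+2)^`M(i)))@_m
          = (i == j)%:R * (m i)%:R * (s ^+ k.+2)@_m.
  rewrite mderiv_var; have [->|_] := eqVneq i j.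
    by rewrite !mul1r mcoeff_Xmderiv.
  by rewrite !mul0r mulr0 mcoeff0.
have -> : 'X_j * ('X_i * (s ^+ k.+2)^`M(i)^`M(j))
          = (k.+2%:R * k.+1%:R) *: (s ^+ k * ('X_i * 'X_j)).
  rewrite mderiv_sumX_exp mderivZ mderiv_sumX_exp scalerA -!scalerAr.
  by congr (_ *: _); ring.
rewrite mcoeffZ => H.
by rewrite mulrBl [(m i)%:R * _]mulrC -[(m j)%:R * _ * _]mulrA -H addrC addKr.
Qed.

Lemma quad_formE (Q : 'M[R]_n) :
  quad_form Q = \sum_i \sum_j Q i j *: ('X_i * 'X_j).
Proof.
rewrite /quad_form !mxE exchange_big /=; apply: eq_bigr => j _.
rewrite !mxE mulr_suml; apply: eq_bigr => i _.
by rewrite !mxE -mul_mpolyC; ring.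
Qed.

Lemma pval_quad_formE (Q : 'M[R]_n) x :
  pval (quad_form Q) x = \sum_i \sum_j Q i j * (x i 0 * x j 0).
Proof.
rewrite pval_quad_form mxE exchange_big /=; apply: eq_bigr => j _.
rewrite mxE mulr_suml; apply: eq_bigr => i _.
by rewrite !mxE; ring.
Qed.

Lemma mcoeff_sumX_exp_quad_form k m (Q : 'M[R]_n) :
  k.+2%:R * k.+1%:R * (s ^+ k * quad_form Q)@_m
  = (\sum_i \sum_j Q i j * ((m i)%:R * (m j)%:R) - \sum_i Q i i * (m i)%:R)
    * (s ^+ k.+2)@_m.
Proof.
rewrite quad_formE mulr_sumr raddf_sum mulr_sumr -sumrB mulr_suml.
apply: eq_bigr => i _; rewrite mulr_sumr raddf_sum mulr_sumr /=.
under eq_bigr => j _ do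
  rewrite -scalerAr mcoeffZ mulrCA mcoeff_sumX_expXX mulrA mulrBr.
rewrite -mulr_suml sumrB; congr ((_ - _) * _).
rewrite (bigD1 i) //= eqxx mul1r big1 ?addr0 // => j ji.
by rewrite eq_sym (negbTE ji) mul0r mulr0.
Qed.

(** Each monomial imposes a linear constraint on the admissible values: an upper bound if its
    coefficient c in s^(k+d) is positive, and a condition independent of the value if c = 0. Hence
    the supremum is itself admissible, and the maximum exists. *)
Lemma polya_bound_ge d k (f : {mpoly R[n]}) l : (0 < n)%N ->
  (forall m, 0 <= (s ^+ k * (f - l *: s ^+ d))@_m) -> l <= polya_bound d k f.
Proof.
move=> n0 Al; rewrite /polya_bound /=.
set A := [set _ | _].
have AE x : A x <-> forall m, x * (s ^+ (k + d))@_m <= (s ^+ k * f)@_m.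
  rewrite /A /=; split=> H m; move: (H m);
  by rewrite mulrBr -scalerAr -exprD mcoeffB mcoeffZ subr_ge0.
have A0 : A !=set0 by exists l.
have ubA m x : A x -> 0 < (s ^+ (k + d))@_m ->
    x <= (s ^+ k * f)@_m / (s ^+ (k + d))@_m.
  by move=> /AE Ax c0; rewrite ler_pdivlMr.
have supA : has_sup A.
  (* A pure power of one variable already bounds the admissible values. *)
  split=> //; pose m := (U_(Ordinal n0) *+ (k + d))%MM.
  exists ((s ^+ k * f)@_m / (s ^+ (k + d))@_m) => x Ax; apply: ubA => //.
  by have := mcoeff_sumX_exp_gt0 m; rewrite mdegMn mdeg1 mul1n.
have [||_] := @set_max_spec _ A (sup A); last exact.
  apply/AE => m; have := mcoeff_sumX_exp_ge0 (k + d) m.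
  rewrite le_eqVlt => /predU1P[c0|c0].
    (* For c = 0 the condition is inherited from [l]. *)
    by have /AE/(_ m) := Al; rewrite -c0 !mulr0.
  by rewrite -ler_pdivlMr //; apply: ge_sup => // x Ax; exact: ubA.
exact: sup_upper_bound.
Qed.

End PowersOfSum.

Theorem theorem2 (R : realType) (n : nat) (hn : (1 <= n)%N) (Q : 'M[R]_n)
    (r : nat) (hr : (2 <= r)%N) :
  let f := quad_form Q in
  grid_min r f - polya_bound 2 (r - 2) f
    <= 1 / (r%:R - 1) * (diag_max Q - grid_min r f)
  /\ 1 / (r%:R - 1) * (diag_max Q - grid_min r f)
    <= 1 / (r%:R - 1) * (simplex_max f - simplex_min f).
Proof.
move=> f; have n0 : (0 < n)%N := hn.
(* From here on r = k + 2, so the exponent r - 2 is k and r - 1 = k + 1 is nonzero. *)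
case: r hr => [//|[//|k]] _; rewrite !subSS subn0.
have rE : k.+2%:R - 1 = k.+1%:R :> R by rewrite -[k.+2%:R]natr1 addrK.
have k1 : 0 < k.+1%:R :> R by rewrite ltr0n.
rewrite rE.
have [[x0 gx0 gminE] gmin_le] := @grid_min_spec R n k.+2 f n0 isT.
have [[i0 dmaxE] le_dmax] := diag_max_spec Q n0.
set g := grid_min _ _ in gminE gmin_le *; set D := diag_max _ in dmaxE le_dmax *.
split; last first.
  apply: ler_wpM2l; first by rewrite divr_ge0 // ltW.
  apply: lerB; last by rewrite gminE; apply: simplex_min_le; case: gx0.
  rewrite dmaxE; apply: le_trans (le_simplex_max f (simplex_delta R i0)).
  by rewrite pval_quad_form trmx_delta -rowE -colE !mxE.
rewrite lerBlDr -lerBlDl.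
(* The candidate is l = g - (D - g) / (r - 1), which is to be shown admissible. *)
apply: polya_bound_ge => // m; set l := _ - _.
rewrite mulrBr -scalerAr -exprD addn2 mcoeffB mcoeffZ subr_ge0.
have k2 : 0 < k.+2%:R :> R by rewrite ltr0n.
rewrite -(ler_pM2l (mulr_gt0 k2 k1)) mcoeff_sumX_exp_quad_form mulrA.
(* In degrees other than r both sides vanish. *)
have [mk|mk] := eqVneq (mdeg m) k.+2; last first.
  by rewrite mcoeff_sumX_exp0 // !mulr0.
rewrite ler_wpM2r ?mcoeff_sumX_exp_ge0 //.
have msum : \sum_i (m i)%:R = k.+2%:R :> R by rewrite -natr_sum -mdegE mk.
pose x : 'cV[R]_n := \col_i ((m i)%:R / k.+2%:R).
have gx : grid R n k.+2 x.
  split=> [|i]; last by rewrite mxE mulrC divfK ?gt_eqF.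
  split=> [i|]; first by rewrite mxE divr_ge0.
  under eq_bigr do rewrite mxE.
  by rewrite -mulr_suml msum divff ?gt_eqF.
(* By homogeneity the right side is r^2 f(m / r), and m / r is a grid point. *)
have lbS : k.+2%:R ^+ 2 * g <= \sum_i \sum_j Q i j * ((m i)%:R * (m j)%:R).
  apply: le_trans (ler_wpM2l (exprn_ge0 2 (ltW k2)) (gmin_le _ gx)) _.
  rewrite pval_quad_formE mulr_sumr le_eqVlt; apply/predU1P; left.
  apply: eq_bigr => i _; rewrite mulr_sumr; apply: eq_bigr => j _.
  by rewrite !mxE; field; rewrite -natrD pnatr_eq0.
have ubD : \sum_i Q i i * (m i)%:R <= D * k.+2%:R.
  rewrite -msum mulr_sumr; apply: ler_sum => i _.
  exact: ler_wpM2r.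
(* The choice of l gives exactly r (r - 1) l = r^2 g - r D. *)
apply: le_trans (lerB lbS ubD); rewrite le_eqVlt; apply/predU1P; left.
by field; rewrite nat1r pnatr_eq0.
Qed.
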